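(* For every $n \geq 2$, the linearization map $\Phi\colon \mathfrak{Q}_n \rightarrow \mathbb{Q}^n$, defined on generators by $\Phi([v]) = v$, is an isomorphism of $\mathbb{Q}$-vector spaces.
   Context: A set $\{v_1,\ldots,v_k\}$ of vectors in a finitely generated free abelian group is a partial basis if it can be extended to a basis. A vector $v \in \mathbb{Z}^n$ is primitive if $\{v\}$ is a partial basis, i.e. $v$ is nonzero and not divisible by any integer $d \geq 2$. $\mathfrak{Q}_n$ is the $\mathbb{Q}$-vector space with the following presentation (the quotient of the free $\mathbb{Q}$-vector space on the generators by the span of the relations). Generators: a formal symbol $[v]$ for every primitive vector $v \in \mathbb{Z}^n$. Relations: for every partial basis $\{v_1,v_2\}$ of $\mathbb{Z}^n$, the relation $[v_1]+[v_2]=[v_1+v_2]$. The formula $\Phi([v])=v$ takes relations to relations, so it gives a well-defined linear map $\mathfrak{Q}_n \to \mathbb{Q}^n$. *)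

(* Defs.v *)
From HB Require Import structures.
From mathcomp Require Import all_boot all_order all_algebra generic_quotient.
From mathcomp Require Import ring_quotient boolp.
From mathcomp.multinomials Require Import freeg.

Set Implicit Arguments.
Unset Strict Implicit.
Unset Printing Implicit Defensive.

Import GRing.Theory Num.Theory.

Local Open Scope ring_scope.
Local Open Scope quotient_scope.

Section LinearQuotient.
Context (R : nzRingType) (V : lmodType R).
Implicit Types (S : V -> Prop) (v : V).

Definition in_span S v : Prop :=
  exists s : seq (R * V),
    (forall p, p \in s -> S p.2) /\ v = \sum_(p <- s) p.1 *: p.2.

Definition lspan S : {pred V} := fun v => `[< in_span S v >].

Lemma lspan_submod_closed S : submod_closed (lspan S).
Proof.
split=> [|a u v /asboolP[s [sS ->]] /asboolP[t [tS ->]]].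
  by apply/asboolP; exists [::]; split=> //; rewrite big_nil.
apply/asboolP; exists ([seq (a * p.1, p.2) | p <- s] ++ t); split=> [p|].
  by rewrite mem_cat => /orP[/mapP[q qs ->]/=|]; [exact: sS | exact: tS].
rewrite big_cat big_map /= scaler_sumr; congr (_ + _).
by apply: eq_bigr => p _; rewrite scalerA.
Qed.

HB.instance Definition _ S :=
  GRing.isSubmodClosed.Build R V (lspan S) (lspan_submod_closed S).

Lemma lspan_gen S v : S v -> v \in lspan S.
Proof.
move=> Sv; apply/asboolP; exists [:: (1, v)]; split=> [p|].
  by rewrite inE => /eqP->.
by rewrite big_seq1 scale1r.
Qed.

Definition lquot S : Type := @Quotient.quot V (lspan S).

HB.instance Definition _ S := Choice.on (lquot S).
HB.instance Definition _ S := GRing.Zmodule.on (lquot S).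
HB.instance Definition _ S := ZmodQuotient.on (lquot S).

Definition lpi S (v : V) : lquot S := \pi_(@Quotient.quot V (lspan S)) v.

Lemma lpiP S u v : reflect (lpi S u = lpi S v) (u - v \in lspan S).
Proof. by rewrite Quotient.idealrBE; exact: eqP. Qed.

Lemma lpiD S u v : lpi S (u + v) = lpi S u + lpi S v.
Proof. exact: (raddfD (\pi_(@Quotient.quot V (lspan S)))). Qed.

Definition lquot_repr S (x : lquot S) : V := repr (x : @Quotient.quot V (lspan S)).

Lemma lquot_reprK S : cancel (@lquot_repr S) (@lpi S).
Proof. exact: reprK. Qed.

Definition lquot_scale S (a : R) (x : lquot S) : lquot S :=
  lpi S (a *: lquot_repr x).

Lemma lpiZ S a v : lpi S (a *: v) = lquot_scale a (lpi S v).
Proof.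
by apply/lpiP; rewrite -scalerBr rpredZ //; apply/lpiP; rewrite lquot_reprK.
Qed.

Lemma lquot_scaleA S a b (x : lquot S) :
  lquot_scale a (lquot_scale b x) = lquot_scale (a * b) x.
Proof. by rewrite -(lquot_reprK x) -!lpiZ scalerA. Qed.

Lemma lquot_scale1 S : left_id 1 (@lquot_scale S).
Proof. by move=> x; rewrite -(lquot_reprK x) -lpiZ scale1r. Qed.

Lemma lquot_scaleDr S : right_distributive (@lquot_scale S) +%R.
Proof.
move=> a x y; rewrite -(lquot_reprK x) -(lquot_reprK y).
by rewrite -lpiD -!lpiZ scalerDr lpiD.
Qed.

Lemma lquot_scaleDl S (x : lquot S) :
  {morph (@lquot_scale S)^~ x : a b / a + b}.
Proof. by move=> a b; rewrite -(lquot_reprK x) -!lpiZ scalerDl lpiD. Qed.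

HB.instance Definition _ S := GRing.Zmodule_isLmodule.Build R (lquot S)
  (@lquot_scaleA S) (@lquot_scale1 S) (@lquot_scaleDr S) (@lquot_scaleDl S).

Lemma lpi_is_linear S : linear (lpi S).
Proof. by move=> a u v; rewrite lpiD lpiZ. Qed.

HB.instance Definition _ S :=
  GRing.isLinear.Build R V (lquot S) *:%R (lpi S) (lpi_is_linear S).

Section Lift.
Context (S : V -> Prop) (W : lmodType R) (f : {linear V -> W}).
Context (fS : forall v, S v -> f v = 0).

(* The hypothesis is an argument so that the linear structure below can be
   keyed on lquot_lift. *)
Definition lquot_lift & (forall v, S v -> f v = 0) :=
  fun x : lquot S => f (lquot_repr x).

Lemma lquot_liftE v : lquot_lift fS (lpi S v) = f v.
Proof.
apply/eqP; rewrite -subr_eq0 -raddfB; apply/eqP.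
have /lpiP/asboolP[s [sS ->]] := lquot_reprK (lpi S v).
rewrite raddf_sum big_seq big1 // => p ps.
by rewrite /= linearZZ fS ?scaler0 //; exact: sS.
Qed.

Lemma lquot_lift_is_linear : linear (lquot_lift fS).
Proof.
move=> a x y; rewrite -(lquot_reprK x) -(lquot_reprK y) -linearP /=.
by rewrite !lquot_liftE linearP.
Qed.

HB.instance Definition _ := GRing.isLinear.Build R (lquot S) W *:%R
  (lquot_lift fS) lquot_lift_is_linear.
End Lift.
End LinearQuotient.

Section FreeLift.
Context (R : nzRingType) (K : choiceType) (M : lmodType R) (f : K -> M).

HB.instance Definition _ := GRing.isZmodMorphism.Build {freeg K / R} M
  (fglift f) (lift_is_additive f).

Lemma fglift_is_scalable : scalable (fglift f : {freeg K / R} -> M).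
Proof.
move=> a x; rewrite -[in RHS](freeg_sumE x) [a *: x]/(fgscale a x).
rewrite !raddf_sum /=.
by apply: eq_bigr => k _; rewrite !liftU scalerA.
Qed.

HB.instance Definition _ := GRing.isScalable.Build R {freeg K / R} M *:%R
  (fglift f) fglift_is_scalable.
End FreeLift.

Section PartialBasis.
Context (V : zmodType).
Implicit Types (v : V) (b s t : seq V).

Definition Zcomb b (c : {ffun 'I_(size b) -> int}) : V :=
  \sum_(i < size b) b`_i *~ c i.

Arguments Zcomb : clear implicits.

Definition Zbasis b : Prop := forall v, exists! c, v = Zcomb b c.

(* Uniqueness of coordinates forces the entries of s to be pairwise distinct,
   so partial_basis [:: v1; v2] says that {v1, v2} is a two-element partial
   basis. *)
Definition partial_basis s : Prop := exists t, Zbasis (s ++ t).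

Definition primitive v : Prop := partial_basis [:: v].

Lemma Zbasis_reparam b b'
    (f : {ffun 'I_(size b) -> int} -> {ffun 'I_(size b') -> int})
    (g : {ffun 'I_(size b') -> int} -> {ffun 'I_(size b) -> int}) :
  cancel g f -> (forall c, Zcomb b' c = Zcomb b (g c)) -> cancel f g ->
  Zbasis b -> Zbasis b'.
Proof.
move=> gK gE fK bB v; have [c [vE cU]] := bB v.
exists (f c); split=> [|c' vE']; first by rewrite gE fK.
by rewrite (cU (g c')) ?gK // -gE.
Qed.

Local Definition upd n (c : {ffun 'I_n.+2 -> int}) (x y : int) :
    {ffun 'I_n.+2 -> int} :=
  [ffun i : 'I_n.+2 =>
     if i == 0%N :> nat then x else if i == 1%N :> nat then y else c i].

Local Definition one {n} : 'I_n.+2 := fintype.lift ord0 ord0.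

Local Lemma updK n (c c' : {ffun 'I_n.+2 -> int}) x y :
  (forall i : 'I_n.+2, (1 < i)%N -> c' i = c i) -> c ord0 = x -> c one = y ->
  upd c' x y = c.
Proof.
move=> cc' <- <-; apply/ffunP=> i; rewrite ffunE.
case: eqP => [i0|i0]; first by congr (c _); apply/val_inj.
case: eqP => [i1|i1]; first by congr (c _); apply/val_inj.
by apply: cc'; case: (val i) i0 i1 => [|[|]].
Qed.

Local Lemma Zcomb2 u v t (c : {ffun 'I_(size t).+2 -> int}) :
  Zcomb [:: u, v & t] c =
  u *~ c ord0 + (v *~ c one +
    \sum_(i < size t) t`_i *~ c (fintype.lift ord0 (fintype.lift ord0 i))).
Proof. by rewrite /Zcomb !big_ord_recl. Qed.

Local Lemma Zcomb_upd u v t (c : {ffun 'I_(size t).+2 -> int}) x y :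
  Zcomb [:: u, v & t] (upd c x y) =
  u *~ x + (v *~ y +
    \sum_(i < size t) t`_i *~ c (fintype.lift ord0 (fintype.lift ord0 i))).
Proof.
rewrite Zcomb2 !ffunE /=; do 2!congr (_ + _).
by apply: eq_bigr => i _; rewrite ffunE.
Qed.

Lemma partial_basisl v1 v2 : partial_basis [:: v1; v2] -> primitive v1.
Proof. by case=> t tB; exists (v2 :: t). Qed.

Lemma partial_basisr v1 v2 : partial_basis [:: v1; v2] -> primitive v2.
Proof.
case=> t tB; exists (v1 :: t).
pose f (c : {ffun 'I_(size t).+2 -> int}) := upd c (c one) (c ord0).
have fK : cancel f f.
  move=> c; apply: updK => [i||]; rewrite !ffunE //.
  by case: i => [[|[|]]].
apply: (@Zbasis_reparam [:: v1, v2 & t] [:: v2, v1 & t] f f fK _ fK tB) => c.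
by rewrite Zcomb_upd Zcomb2 addrCA.
Qed.

Lemma partial_basisD v1 v2 : partial_basis [:: v1; v2] -> primitive (v1 + v2).
Proof.
case=> t tB; exists (v2 :: t).
pose f (c : {ffun 'I_(size t).+2 -> int}) := upd c (c ord0) (c one - c ord0).
pose g (c : {ffun 'I_(size t).+2 -> int}) := upd c (c ord0) (c one + c ord0).
have gK : cancel g f.
  move=> c; apply: updK => [i||]; rewrite !ffunE ?addrK //.
  by case: i => [[|[|]]].
have fK : cancel f g.
  move=> c; apply: updK => [i||]; rewrite !ffunE ?subrK //.
  by case: i => [[|[|]]].
apply: (@Zbasis_reparam [:: v1, v2 & t] [:: v1 + v2, v2 & t]
          f g gK _ fK tB) => c.
by rewrite Zcomb_upd Zcomb2 mulrzDl mulrzDr -!addrA; congr (_ + _); rewrite addrCA.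
Qed.

End PartialBasis.

Arguments Zcomb {V} b c.

Section Presentation.
Context (n : nat).

(* Z^n is the group of integer row vectors. *)
Definition primvec : choiceType := {v : 'rV[int]_n | `[< primitive v >]}.

Definition symb (v : 'rV[int]_n) (vP : primitive v) : {freeg primvec / rat} :=
  << (exist _ v (asboolT vP) : primvec) >>.

Definition relator (x : {freeg primvec / rat}) : Prop :=
  exists (v1 v2 : 'rV[int]_n) (B : partial_basis [:: v1; v2]),
    x = symb (partial_basisl B) + symb (partial_basisr B)
        - symb (partial_basisD B).

Definition Qpres : lmodType rat := lquot relator.

Definition bracket (v : 'rV[int]_n) (vP : primitive v) : Qpres :=
  lpi relator (symb vP).

Definition ratvec (v : 'rV[int]_n) : 'rV[rat]_n := map_mx intr v.

Definition free_linearization : {linear {freeg primvec / rat} -> 'rV[rat]_n} :=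
  fglift (fun v : primvec => ratvec (val v)).

Lemma free_linearization_symb v (vP : primitive v) :
  free_linearization (symb vP) = ratvec v.
Proof. by rewrite /= liftU scale1r. Qed.

Lemma free_linearization_relator x : relator x -> free_linearization x = 0.
Proof.
case=> v1 [v2 [B ->]].
rewrite raddfB raddfD /=; rewrite !free_linearization_symb.
by rewrite /ratvec map_mxD subrr.
Qed.

Definition linearization : {linear Qpres -> 'rV[rat]_n} :=
  lquot_lift free_linearization_relator.

Lemma linearizationE v (vP : primitive v) :
  linearization (bracket vP) = ratvec v.
Proof. exact: etrans (lquot_liftE _ _) (free_linearization_symb vP). Qed.

End Presentation.

(* Main.v *)
From HB Require Import structures.
Require Import Defs.
From mathcomp Require Import all_boot all_order all_algebra.
From mathcomp Require Import boolp zify.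
From mathcomp.multinomials Require Import freeg.

(** The candidate inverse of [linearization] is the linear map [delinearize]
    sending the unit vector e_i to the bracket of e_i.  It is visibly a right
    inverse; it is a left inverse as soon as the bracket of every primitive v is
    the expected combination of the brackets of the e_i, a property of v called
    [recovered].

    The relation between the brackets of x, y and x + y, for a partial basis
    x, y, makes [recovered] satisfy a two-out-of-three rule: it passes from x
    and y to x + y, and from x and x + y to y.  Hence a basis whose vectors are
    all recovered stays so under the elementary operations b_j := b_j + b_i and
    b_j := b_j - b_i ([frame_rowop]), and -b_i is recovered too, because
    b_j = (b_i + b_j) + (-b_i); this last point is where a second basis vector,
    hence n >= 2, is needed.

    Start from the standard basis and a primitive v = sum_k c_k b_k
    ([recovered_frame]).  If two coordinates are nonzero, say
    0 < |c_j| <= |c_i|, then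
      c_i b_i + c_j b_j = (c_i - s c_j) b_i + c_j (b_j + s b_i)
    with s the sign of c_i c_j: a change of basis of the allowed kind that
    lowers sum_k |c_k|.  This Euclidean descent stops when v is an integer
    multiple of a single b_i, and primitivity forces v = b_i or v = -b_i
    ([primitive_mulrz]). *)

Set Implicit Arguments.
Unset Strict Implicit.
Unset Printing Implicit Defensive.

Import GRing.Theory Num.Theory.

Local Open Scope ring_scope.

(** * Bases of Z^n from invertible integer matrices *)

(** If M is invertible, the coordinates of v in the rows of M are the entries of
    v *m invmx M; [s] lists these rows in an arbitrary order, so that any chosen
    rows can be brought to the front. *)
Lemma Zbasis_rows n (M : 'M[int]_n) (s : seq 'I_n) :
  M \in unitmx -> uniq s -> s =i predT -> Zbasis [seq row k M | k <- s].
Proof.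
move=> MU sU sT v; set b := [seq row k M | k <- s].
have sz (i : 'I_(size b)) : (i < size s)%N.
  by rewrite -(size_map (fun k => row k M) s).
(* The row of M that sits in position i of b. *)
pose k (i : 'I_(size b)) : 'I_n := tnth (in_tuple s) (Ordinal (sz i)).
have kE i : k i = nth (k i) s i by exact: tnth_nth.
have bE (i : 'I_(size b)) : b`_i = row (k i) M.
  by rewrite (nth_map (k i)) ?sz // -kE.
have kI : injective k.
  move=> i j kij; apply/val_inj/eqP.
  rewrite -(nth_uniq (k i) (sz i) (sz j) sU) -kE {2}kij.
  by rewrite (set_nth_default (k j)) ?sz // -kE kij.
have kS (h : 'I_n) : exists i, k i = h.
  have hs : h \in s by rewrite sT.
  have hb : (index h s < size b)%N by rewrite size_map index_mem.
  by exists (Ordinal hb); rewrite kE nth_index.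
have rowK (c : {ffun 'I_(size b) -> int}) i :
    (Zcomb b c *m invmx M) 0 (k i) = c i.
  rewrite /Zcomb mulmx_suml summxE (bigD1 i) //= big1 => [|j ji].
    rewrite addr0 bE -scaler_int -scalemxAl -row_mul mulmxV // !mxE eqxx mulr1.
    by rewrite intz.
  rewrite bE -scaler_int -scalemxAl -row_mul mulmxV // !mxE.
  by rewrite (inj_eq kI) (negPf ji) mulr0.
exists [ffun i => (v *m invmx M) 0 (k i)]; split=> [|c ->]; last first.
  by apply/ffunP=> i; rewrite ffunE rowK.
apply: (can_inj (mulmxK (_ : invmx M \in unitmx))); first by rewrite unitmx_inv.
apply/rowP=> h; have [i <-] := kS h.
by rewrite rowK ffunE.
Qed.

Lemma partial_basis_rows n (M : 'M[int]_n) (s : seq 'I_n) :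
  M \in unitmx -> uniq s -> partial_basis [seq row k M | k <- s].
Proof.
move=> MU sU; exists [seq row k M | k <- enum 'I_n & k \notin s].
rewrite -map_cat; apply: Zbasis_rows => // [|k].
  rewrite cat_uniq sU filter_uniq ?enum_uniq // andbT.
  by apply/hasPn => k; rewrite mem_filter => /andP[].
by rewrite mem_cat mem_filter mem_enum andbT orbN.
Qed.

(** In a basis starting with u *~ d, the first coordinate of u *~ d is 1, but it
    is also d times the first coordinate of u; so d is a unit of Z. *)
Lemma primitive_mulrz (V : zmodType) (u : V) (d : int) :
  primitive (u *~ d) -> d = 1 \/ d = -1.
Proof.
case=> t tB; have [a [uE _]] := tB u; have [c [_ cU]] := tB (u *~ d).
pose c1 : {ffun 'I_(size ([:: u *~ d] ++ t)) -> int} :=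
  [ffun i => (i == ord0)%:R].
pose c2 : {ffun 'I_(size ([:: u *~ d] ++ t)) -> int} := [ffun i => a i * d].
have c1E : u *~ d = Zcomb _ c1.
  rewrite /Zcomb big_ord_recl big1 => [|i _]; first by rewrite ffunE addr0.
  by rewrite ffunE.
have c2E : u *~ d = Zcomb _ c2.
  rewrite {1}uE /Zcomb mulrz_suml; apply: eq_bigr => i _.
  by rewrite ffunE mulrzA.
have := etrans (esym (cU _ c1E)) (cU _ c2E).
move=> /ffunP/(_ ord0); rewrite !ffunE /= => ad.
have /orP[/eqP->|/eqP->] : d \is a GRing.unit; [|by left|by right].
by apply/unitrPr; exists (a ord0); rewrite mulrC.
Qed.

(** * Elementary row operations *)

Section RowOperations.
Context (n : nat).
Implicit Types (i j k : 'I_n) (M : 'M[int]_n).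

(** Multiplication on the left adds s times row i to row j.  The indices may
    coincide: [rowop i i (- 2)] changes the sign of row i. *)
Definition rowop i j (s : int) : 'M[int]_n := 1%:M + s *: delta_mx j i.

Lemma rowopK i j s : i != j -> rowop i j (- s) *m rowop i j s = 1%:M.
Proof.
move=> ij; rewrite /rowop mulmxDl !mulmxDr !mul1mx mulmx1 -scalemxAl -scalemxAr.
by rewrite mul_delta_mx_0 // !scaler0 addr0 scaleNr addrK.
Qed.

Lemma rowop_unit i j s : i != j -> rowop i j s \in unitmx.
Proof. by move=> ij; have /mulmx1_unit[] := rowopK s ij. Qed.

Lemma rowop_opp_unit i : rowop i i (- 2) \in unitmx.
Proof.
have /mulmx1_unit[//] : rowop i i (- 2) *m rowop i i (- 2) = 1%:M.
rewrite /rowop mulmxDl !mulmxDr !mul1mx mulmx1 -scalemxAl -scalemxAr.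
rewrite mul_delta_mx scalerA -!addrA -!scalerDl.
by rewrite (_ : - 2 + _ = 0 :> int) // scale0r addr0.
Qed.

Lemma row_rowop i j s M k :
  row k (rowop i j s *m M) = row k M + (s *+ (k == j)) *: row i M.
Proof.
apply/rowP=> l; rewrite mulmxDl mul1mx -scalemxAl !mxE (bigD1 i) //= big1.
  rewrite !mxE eqxx andbT addr0.
  by case: (k == j); rewrite ?mul1r ?mul0r ?mulr0.
by move=> m mi; rewrite !mxE (negPf mi) andbF mul0r.
Qed.

Lemma mul_row_rowop i j s (c : 'rV[int]_n) k :
  (c *m rowop i j s) 0 k = c 0 k + (s * c 0 j) *+ (k == i).
Proof.
rewrite mulmxDr mulmx1 -scalemxAr !mxE (bigD1 j) //= big1 => [|m mj].
  by rewrite !mxE eqxx addr0 /=; case: (k == i); rewrite ?mulr1 ?mulr0.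
by rewrite !mxE (negPf mj) /= mulr0.
Qed.

End RowOperations.

(** * The candidate inverse *)

Section Inverse.
Context (n : nat).

Lemma primitive_delta (i : 'I_n) : primitive (row i 1%:M : 'rV[int]_n).
Proof. exact: (@partial_basis_rows n 1%:M [:: i] (unitmx1 _ _) isT). Qed.

Definition delinearize (x : 'rV[rat]_n) : Qpres n :=
  \sum_i x 0 i *: bracket (primitive_delta i).

Fact delinearize_is_linear : linear delinearize.
Proof.
move=> a x y; rewrite /delinearize scaler_sumr -big_split.
apply: eq_bigr => i _.
by rewrite !mxE scalerDl scalerA.
Qed.

HB.instance Definition _ :=
  GRing.isLinear.Build rat 'rV[rat]_n (Qpres n) *:%R delinearize
    delinearize_is_linear.

Lemma bracket_irr (v : 'rV[int]_n) (p q : primitive v) : bracket p = bracket q.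
Proof. by rewrite (Prop_irrelevance p q). Qed.

Lemma bracketD (x y : 'rV[int]_n) (B : partial_basis [:: x; y]) :
  bracket (partial_basisD B) =
  bracket (partial_basisl B) + bracket (partial_basisr B).
Proof.
apply/esym; rewrite /bracket -lpiD; apply/lpiP/lspan_gen.
by exists x, y, B.
Qed.

(** Quantifying over the proof of primitivity makes this a property of the
    vector alone. *)
Definition recovered (v : 'rV[int]_n) : Prop :=
  forall vP : primitive v, bracket vP = delinearize (ratvec v).

Lemma recovered_delta i : recovered (row i 1%:M).
Proof.
move=> vP; rewrite /delinearize (bigD1 i) //= big1 => [|j ji].
  by rewrite !mxE eqxx scale1r addr0; exact: bracket_irr.
by rewrite !mxE eq_sym (negPf ji) scale0r.
Qed.

Lemma recoveredD x y :
  partial_basis [:: x; y] -> recovered x -> recovered y -> recovered (x + y).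
Proof.
move=> B xR yR vP; rewrite (bracket_irr vP (partial_basisD B)) bracketD xR yR.
by rewrite /ratvec map_mxD linearD.
Qed.

Lemma recoveredB x y : partial_basis [:: x; y] ->
  recovered x -> recovered (x + y) -> recovered y.
Proof.
move=> B xR yR vP; have := bracketD B.
rewrite (bracket_irr _ vP) xR yR /ratvec map_mxD linearD /=.
by move/addrI.
Qed.

(** * Bases consisting of recovered vectors *)

Definition frame (M : 'M[int]_n) : Prop :=
  M \in unitmx /\ forall k, recovered (row k M).

(** For s = 1 this is the relation of the partial basis b_j, b_i; for s = -1 it
    is that of the partial basis b_i, b_j - b_i, whose sum is b_j. *)
Lemma recovered_add_row M i j (s : int) : frame M -> i != j ->
  s = 1 \/ s = -1 -> recovered (row j M + s *: row i M).
Proof.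
move=> [MU MR] ij [->|->]; rewrite ?scale1r ?scaleN1r.
  apply: recoveredD => //.
  apply: (@partial_basis_rows n M [:: j; i]) => //.
  by rewrite /= inE eq_sym ij.
apply: (@recoveredB (row i M)) => //; last by rewrite addrC subrK.
have TU : rowop i j (-1) *m M \in unitmx by rewrite unitmx_mul rowop_unit.
have ijU : uniq [:: i; j] by rewrite /= inE ij.
have := partial_basis_rows TU ijU.
by rewrite /= !row_rowop (negPf ij) eqxx scale0r addr0 scaleN1r.
Qed.

Lemma frame_rowop M i j (s : int) : frame M -> i != j ->
  s = 1 \/ s = -1 -> frame (rowop i j s *m M).
Proof.
move=> fM ij s1; have [MU MR] := fM; split=> [|k].
  by rewrite unitmx_mul rowop_unit.
rewrite row_rowop; have [->|_] := eqVneq k j; first exact: recovered_add_row.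
by rewrite scale0r addr0.
Qed.

(** From b_j = (b_i + b_j) + (-b_i), a relation of the partial basis
    b_i + b_j, -b_i. *)
Lemma recovered_opp_row M i j : frame M -> i != j -> recovered (- row i M).
Proof.
move=> fM ij; have [MU MR] := fM.
have [NU] := frame_rowop fM ij (or_introl erefl).
set N := rowop i j 1 *m M in NU *; move=> NR.
have Ni : row i N = row i M by rewrite row_rowop (negPf ij) scale0r addr0.
have Nj : row j N = row j M + row i M by rewrite row_rowop eqxx scale1r.
clearbody N; apply: (@recoveredB (row j N)) => //; last by rewrite Nj addrK.
have TU : rowop i i (- 2) *m N \in unitmx by rewrite unitmx_mul rowop_opp_unit.
have jiU : uniq [:: j; i] by rewrite /= inE eq_sym ij.
have := partial_basis_rows TU jiU.
rewrite /= !row_rowop eqxx (eq_sym j) (negPf ij) scale0r addr0 Ni.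
by rewrite mulr1n scaleNr scaler_nat mulr2n opprD addNKr.
Qed.

(** * Euclidean descent on the coordinates *)

(** By induction on the sum of the absolute values of the coordinates c of the
    vector in the basis M, both c and M being allowed to vary. *)
Lemma recovered_frame (n_ge2 : (2 <= n)%N) M (c : 'rV[int]_n) :
  frame M -> primitive (c *m M) -> recovered (c *m M).
Proof.
have [N] := ubnP (\sum_k `|c 0%R k|)%N; elim: N => // N IH in M c *.
rewrite ltnS => cN fM vP.
have [[i [j [ij ci0 cj0 cij]]]|/forallNP sparse] :=
  pselect (exists i j, [/\ i != j, c 0 i != 0, c 0 j != 0 &
                            (`|c 0%R j| <= `|c 0%R i|)%N]).
  (* s is the sign of c_i c_j, so that c_i - s c_j is closer to 0 than c_i. *)
  have [s [s1 lt_s]] : exists s : int, (s = 1 \/ s = -1) /\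
      (`|(c 0 i - s * c 0 j)%R| < `|c 0%R i|)%N.
    have [h|h] : (0 <= c 0 i * c 0 j) \/ (c 0 i * c 0 j <= 0) by lia.
      by exists 1; split; [left|nia].
    by exists (-1); split; [right|nia].
  have cM : c *m M = (c *m rowop i j (- s)) *m (rowop i j s *m M).
    by rewrite mulmxA -[in RHS](mulmxA c) rowopK // mulmx1.
  rewrite cM in vP *; apply: IH => //; last exact: frame_rowop.
  apply: leq_trans cN; rewrite (bigD1 i) // [X in (_ < X)%N](bigD1 i) //=.
  rewrite -addSn leq_add //.
    by rewrite mul_row_rowop // eqxx mulNr.
  apply: leq_sum => k ki; rewrite mul_row_rowop // (negPf ki).
  by rewrite addr0.
(* At most one coordinate is nonzero, the vector being a multiple of row i. *)
have [i ci] : exists i, forall k, k != i -> c 0 k = 0.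
  have [[i ci]|/forallNP c0] := pselect (exists i, c 0 i != 0); last first.
    exists (Ordinal (ltnW n_ge2)) => k _.
    by apply/eqP/negP => /negP; exact: c0.
  exists i => k ki; apply/eqP/negP => /negP ck.
  have [le|/ltnW le] := leqP `|c 0%R k|%N `|c 0%R i|%N.
    by apply: (sparse i); exists k; rewrite eq_sym.
  by apply: (sparse k); exists i.
have cE : c *m M = row i M *~ c 0 i.
  rewrite mulmx_sum_row (bigD1 i) //= big1 => [|k ki]; last first.
    by rewrite ci // scale0r.
  by rewrite addr0 -scaler_int intz.
rewrite cE in vP *; have [->|->] := primitive_mulrz vP.
  by rewrite mulr1z; case: fM.
have [j ij] : exists j, i != j.
  have [->|] := eqVneq i (Ordinal n_ge2); last by exists (Ordinal n_ge2).
  by exists (Ordinal (ltnW n_ge2)).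
rewrite mulrNz mulr1z; exact: recovered_opp_row ij.
Qed.

Lemma recovered_primitive (n_ge2 : (2 <= n)%N) v :
  primitive v -> recovered v.
Proof.
move=> vP; have := @recovered_frame n_ge2 1%:M v; rewrite mulmx1; apply=> //.
by split; [exact: unitmx1|exact: recovered_delta].
Qed.

(** * Mutual inverses *)

Lemma delinearizeK : cancel delinearize (linearization n).
Proof.
move=> x; rewrite linear_sum [RHS]row_sum_delta; apply: eq_bigr => i _.
rewrite linearZ_LR linearizationE; congr (_ *: _).
by apply/rowP=> j; rewrite !mxE eq_sym; case: (j == i).
Qed.

(** Brackets span the quotient, and on a bracket the claim is
    [recovered_primitive]. *)
Lemma linearizationK (n_ge2 : (2 <= n)%N) :
  cancel (linearization n) delinearize.
Proof.
move=> x; rewrite -[x]lquot_reprK -[lquot_repr x]freeg_sumE.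
rewrite !linear_sum; apply: eq_bigr => -[v vP'] _.
have vP : primitive v by exact/asboolP.
have -> : << coeff (exist _ v vP') (lquot_repr x) *g exist _ v vP' >> =
    coeff (exist _ v vP') (lquot_repr x) *: symb vP.
  apply/eqP/freeg_eqP => w; rewrite coeffZ !coeffU mul1r.
  by congr (_ * (_ == _)%:R); apply: val_inj.
rewrite !linearZ_LR -/(bracket vP) linearizationE; congr (_ *: _).
exact/esym/(recovered_primitive n_ge2 vP).
Qed.

End Inverse.

Theorem theorem1 (n : nat) (n_ge2 : (2 <= n)%N) :
  bijective (linearization n).
Proof.
exists (@delinearize n); [exact: linearizationK|exact: delinearizeK].
Qed.
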